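(* Under the misère-play convention, there is an infinite number (with respect to distinguishability) of absolute universes strictly between the dicot universe $\mathbb{D}$ and the dead-ending universe $\mathbb{E}$. That is, there is an infinite family $\mathcal F$ of absolute universes such that every $\mathbb{U}\in\mathcal F$ satisfies $\mathbb{D}\subseteq\mathbb{U}\subseteq\mathbb{E}$, $\mathbb{U}$ is a proper extension of $\mathbb{D}$ and $\mathbb{E}$ is a proper extension of $\mathbb{U}$; and of any two different members of $\mathcal F$ one is a proper extension of the other.
   Context: Game forms: $\Omega$ is the set of all short (finite, loop-free) partizan game forms $G=\{G^{\mathcal L}\mid G^{\mathcal R}\}$, built recursively from $\mathbf 0=\{\varnothing\mid\varnothing\}$, where $G^{\mathcal L}, G^{\mathcal R}$ are finite (possibly empty) sets of previously built forms (the Left and Right options). Forms are not identified under any equivalence. The disjunctive sum is $G+H=\{G^{\mathcal L}+H,\,G+H^{\mathcal L}\mid G^{\mathcal R}+H,\,G+H^{\mathcal R}\}$, and the conjugate of $G$ is obtained by recursively swapping the roles of Left and Right. Universe: a set $\mathbb{U}\subseteq\Omega$ is a universe if $\mathbf 0\in\mathbb{U}$ and $\mathbb{U}$ is closed under disjunctive sum, under conjugation, and under taking options. It is parental if for all finite non-empty sets $\mathcal G,\mathcal H\subseteq\mathbb{U}$ the form $\{\mathcal G\mid\mathcal H\}$ belongs to $\mathbb{U}$. An absolute universe is a parental universe (the further requirement of ''outcome saturation'' is a consequence of parentality). Dicot: $G$ is a dicot if ($G^{\mathcal L}=\varnothing\Leftrightarrow G^{\mathcal R}=\varnothing$) and all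 options of $G$ are dicots; $\mathbb{D}$ is the universe of all dicots. Dead-ending: $G$ is dead-ending if whenever, in a position reachable from $G$ (including $G$ itself) by any sequence of moves, a player has no move, that player also has no move after any sequence of moves by the other player from that position; $\mathbb{E}$ is the universe of all dead-ending forms. Misère-play: players alternate, and a player who cannot move on their turn wins. The outcome $o(G)\in\{\mathscr L,\mathscr R,\mathscr N,\mathscr P\}$ records whether, under optimal play, Left wins no matter who starts, Right wins no matter who starts, the next (starting) player wins, or the previous (second) player wins. Distinguishability: for a universe $\mathbb{U}$, forms $G,H\in\mathbb{U}$ are distinguishable modulo $\mathbb{U}$ if there is $X\in\mathbb{U}$ with $o(G+X)\neq o(H+X)$. For universes $\mathbb{U}\subseteq\mathbb{U}'$, $\mathbb{U}'$ is a proper extension of $\mathbb{U}$ if there is $G\in\mathbb{U}'$ such that for all $H\in\mathbb{U}$, $G$ and $H$ are distinguishable modulo $\mathbb{U}'$. *)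

(* Defs.v *)
From HB Require Import structures.
From mathcomp Require Import all_boot finmap generic_quotient.
From mathcomp Require Import boolp classical_sets cardinality.

Set Implicit Arguments.
Unset Strict Implicit.
Unset Printing Implicit Defensive.

Local Open Scope quotient_scope.
Local Open Scope fset_scope.

Inductive player : Set := Left | Right.

Definition opponent (p : player) : player :=
  match p with Left => Right | Right => Left end.

Lemma opponentK : involutive opponent. Proof. by case. Qed.

(** A game form is a hereditarily finite pair of _sets_ of game forms.  Such a
    type is not strictly positive, so [form] is the quotient of the trees below,
    whose options are listed, by the hereditary identification of lists having
    the same elements.  The only consequence is that the order and the
    repetitions of the options are forgotten (see [form_ext]): no game
    equivalence is factored out. *)
Inductive tree : Type := Node of seq tree & seq tree.

HB.instance Definition _ := gen_eqMixin tree.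
HB.instance Definition _ := gen_choiceMixin tree.

Definition topts (p : player) (s : tree) : seq tree :=
  let: Node l r := s in match p with Left => l | Right => r end.

Fixpoint same (s t : tree) {struct s} : bool :=
  let: Node sl sr := s in
  let: Node tl tr := t in
  [&& all (fun x => has (same x) tl) sl,
      all (fun y => has (fun x => same x y) sl) tl,
      all (fun x => has (same x) tr) sr &
      all (fun y => has (fun x => same x y) sr) tr].

Lemma tree_opts_ind (P : tree -> Prop) :
  (forall s, (forall p x, x \in topts p s -> P x) -> P s) -> forall s, P s.
Proof.
move=> IH; fix loop 1 => s; apply: IH => p.
case: s => l r; case: p => /=.
- elim: l => [|a l IHl] x; first by clear loop; rewrite in_nil.
  rewrite in_cons => /orP[/eqP->|]; first exact: loop.
  exact: IHl.
- elim: r => [|a r IHr] x; first by clear loop; rewrite in_nil.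
  rewrite in_cons => /orP[/eqP->|]; first exact: loop.
  exact: IHr.
Qed.

Lemma sameP (s t : tree) :
  same s t <->
  forall p, (forall x, x \in topts p s -> exists2 y, y \in topts p t & same x y) /\
            (forall y, y \in topts p t -> exists2 x, x \in topts p s & same x y).
Proof.
case: s t => [sl sr] [tl tr] /=; split.
  case/and4P=> /allP h1 /allP h2 /allP h3 /allP h4 [] /=; split=> x xin.
  - by have /hasP := h1 _ xin.
  - by have /hasP := h2 _ xin.
  - by have /hasP := h3 _ xin.
  - by have /hasP := h4 _ xin.
move=> h; have [hl1 hl2] := h Left; have [hr1 hr2] := h Right.
apply/and4P; split; apply/allP => x xin; apply/hasP.
- exact: hl1.
- exact: hl2.
- exact: hr1.
- exact: hr2.
Qed.

Lemma same_refl : reflexive same.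
Proof.
elim/tree_opts_ind => s IH; apply/sameP => p.
by split=> x xin; exists x => //; apply: IH xin.
Qed.

Lemma same_sym : symmetric same.
Proof.
suff h s t : same s t -> same t s by move=> s t; apply/idP/idP; apply: h.
elim/tree_opts_ind: s t => s IH t /sameP st; apply/sameP => p.
have [h1 h2] := st p; split.
- by move=> x /h2[y yin yx]; exists y => //; exact: (IH _ _ yin).
- by move=> y yin; have [x xin yx] := h1 _ yin; exists x => //; exact: (IH _ _ yin).
Qed.

Lemma same_trans : transitive same.
Proof.
move=> t s u; elim/tree_opts_ind: s t u => s IH t u /sameP st /sameP tu.
apply/sameP => p; have [h1 h2] := st p; have [k1 k2] := tu p; split.
- move=> x xin; have [y yin xy] := h1 _ xin; have [z zin yz] := k1 _ yin.
  by exists z => //; exact: (IH _ _ xin _ _ xy yz).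
- move=> z zin; have [y yin yz] := k2 _ zin; have [x xin xy] := h2 _ yin.
  by exists x => //; exact: (IH _ _ xin _ _ xy yz).
Qed.

Canonical same_equiv := EquivRel same same_refl same_sym same_trans.

(** The set [Omega] of all short partizan game forms. *)
Definition form : choiceType := {eq_quot same}.

Definition form_of (s : tree) : form := \pi_{eq_quot same} s.

Definition opts (p : player) (G : form) : {fset form} :=
  [fset form_of x | x in topts p (repr G)].

(** [mkform A B] is the form {A | B}. *)
Definition mkform (A B : {fset form}) : form :=
  form_of (Node (map repr A) (map repr B)).

Definition form_zero : form := mkform fset0 fset0.

Lemma form_ofP (s t : tree) : form_of s = form_of t <-> same s t.
Proof. by split=> [/eqmodP|h]//; apply/eqmodP. Qed.

Lemma form_of_repr (G : form) : form_of (repr G) = G.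
Proof. exact: reprK. Qed.

Lemma same_repr (s : tree) : same (repr (form_of s)) s.
Proof. by apply/form_ofP; rewrite form_of_repr. Qed.

Lemma in_opts_form_of (p : player) (s : tree) (H : form) :
  H \in opts p (form_of s) <-> exists2 x, x \in topts p s & H = form_of x.
Proof.
have /sameP/(_ p)[h1 h2] := same_repr s; split.
- case/imfsetP => x /= xin ->; have [y yin xy] := h1 _ xin.
  by exists y => //; apply/form_ofP.
- case=> y yin ->; have [x xin xy] := h2 _ yin.
  by apply/imfsetP; exists x => //=; apply/esym/form_ofP.
Qed.

Lemma opts_mkform (p : player) (A B : {fset form}) :
  opts p (mkform A B) = match p with Left => A | Right => B end.
Proof.
apply/fsetP => H; apply/idP/idP => [/in_opts_form_of|hH].
- by case: p => -[x /= /mapP[K Kin ->] ->]; rewrite form_of_repr.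
- apply/in_opts_form_of; exists (repr H); last by rewrite form_of_repr.
  by case: p hH => /= hH; apply/mapP; exists H.
Qed.

Lemma form_ext (G H : form) : (forall p, opts p G = opts p H) -> G = H.
Proof.
move=> e; rewrite -(form_of_repr G) -(form_of_repr H); apply/form_ofP/sameP => p.
split=> [x xin|y yin].
- have : form_of x \in opts p G by apply/imfsetP; exists x.
  by rewrite e => /imfsetP[y /= yin /form_ofP]; exists y.
- have : form_of y \in opts p H by apply/imfsetP; exists y.
  by rewrite -e => /imfsetP[x /= xin /form_ofP]; exists x; rewrite // same_sym.
Qed.

Lemma mkform_opts (G : form) : mkform (opts Left G) (opts Right G) = G.
Proof. by apply: form_ext => -[]; rewrite opts_mkform. Qed.

Lemma form_ind (P : form -> Prop) :
  (forall G, (forall p H, H \in opts p G -> P H) -> P G) -> forall G, P G.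
Proof.
move=> IH G; rewrite -(form_of_repr G); elim/tree_opts_ind: (repr G) => s IHs.
by apply: IH => p H /in_opts_form_of[x xin ->]; apply: IHs xin.
Qed.

(** Disjunctive sum and conjugate, computed on representatives; [opts_form_add] and
    [opts_form_conj] are their defining equations on forms. *)
Fixpoint tadd (s : tree) : tree -> tree :=
  fix tadd_s (t : tree) : tree :=
    let: Node sl sr := s in
    let: Node tl tr := t in
    Node (map (fun x => tadd x t) sl ++ map tadd_s tl)
         (map (fun x => tadd x t) sr ++ map tadd_s tr).

Definition form_add (G H : form) : form := form_of (tadd (repr G) (repr H)).

Fixpoint tconj (s : tree) : tree :=
  let: Node l r := s in Node (map tconj r) (map tconj l).

Definition form_conj (G : form) : form := form_of (tconj (repr G)).

Lemma topts_tadd (p : player) (s t : tree) :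
  topts p (tadd s t) =
  map (fun x => tadd x t) (topts p s) ++ map (tadd s) (topts p t).
Proof. by case: s t p => [sl sr] [tl tr] []. Qed.

Lemma topts_tconj (p : player) (s : tree) :
  topts p (tconj s) = map tconj (topts (opponent p) s).
Proof. by case: s p => [sl sr] []. Qed.

Lemma same_tadd (s s' t t' : tree) :
  same s s' -> same t t' -> same (tadd s t) (tadd s' t').
Proof.
elim/tree_opts_ind: s s' t t' => s IHs s' t t' ss'.
elim/tree_opts_ind: t t' => t IHt t' tt'.
apply/sameP => p; rewrite !topts_tadd.
have /sameP/(_ p)[h1 h2] := ss'; have /sameP/(_ p)[k1 k2] := tt'.
split=> z; rewrite mem_cat => /orP[] /mapP[x xin ->].
- have [y yin xy] := h1 _ xin; exists (tadd y t'); last exact: IHs _ _ xin _ _ _ xy tt'.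
  by rewrite mem_cat (map_f (fun x => tadd x t')).
- have [y yin xy] := k1 _ xin; exists (tadd s' y); last exact: IHt _ _ xin _ xy.
  by rewrite mem_cat map_f ?orbT.
- have [y yin xy] := h2 _ xin; exists (tadd y t); last exact: IHs _ _ yin _ _ _ xy tt'.
  by rewrite mem_cat (map_f (fun x => tadd x t)).
- have [y yin xy] := k2 _ xin; exists (tadd s y); last exact: IHt _ _ yin _ xy.
  by rewrite mem_cat map_f ?orbT.
Qed.

Lemma same_tconj (s s' : tree) : same s s' -> same (tconj s) (tconj s').
Proof.
elim/tree_opts_ind: s s' => s IHs s' /sameP ss'.
apply/sameP => p; rewrite !topts_tconj; have [h1 h2] := ss' (opponent p).
split=> z /mapP[x xin ->].
- by have [y yin xy] := h1 _ xin; exists (tconj y); [exact: map_f|exact: IHs _ _ xin _ xy].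
- by have [y yin xy] := h2 _ xin; exists (tconj y); [exact: map_f|exact: IHs _ _ yin _ xy].
Qed.

Lemma form_of_tadd (s t : tree) :
  form_of (tadd s t) = form_add (form_of s) (form_of t).
Proof. by apply/esym/form_ofP/same_tadd; apply: same_repr. Qed.

Lemma form_of_tconj (s : tree) : form_of (tconj s) = form_conj (form_of s).
Proof. by apply/esym/form_ofP/same_tconj/same_repr. Qed.

Lemma opts_form_add (p : player) (G H : form) :
  opts p (form_add G H) =
  [fset form_add G' H | G' in opts p G] `|` [fset form_add G H' | H' in opts p H].
Proof.
apply/fsetP => K; apply/idP/idP.
- case/in_opts_form_of => x; rewrite topts_tadd mem_cat => /orP[] /mapP[y yin ->] ->;
    rewrite form_of_tadd form_of_repr; apply/fsetUP; [left|right];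
    by apply/imfsetP; exists (form_of y) => //; apply/imfsetP; exists y.
- case/fsetUP => /imfsetP[_ /imfsetP[y /= yin ->] ->]; apply/in_opts_form_of.
  + exists (tadd y (repr H)); last by rewrite form_of_tadd form_of_repr.
    by rewrite topts_tadd mem_cat (map_f (fun x => tadd x _)).
  + exists (tadd (repr G) y); last by rewrite form_of_tadd form_of_repr.
    by rewrite topts_tadd mem_cat map_f ?orbT.
Qed.

Lemma opts_form_conj (p : player) (G : form) :
  opts p (form_conj G) = [fset form_conj G' | G' in opts (opponent p) G].
Proof.
apply/fsetP => K; apply/idP/idP.
- case/in_opts_form_of => x; rewrite topts_tconj => /mapP[y yin ->] ->.
  rewrite form_of_tconj; apply/imfsetP; exists (form_of y) => //.
  by apply/imfsetP; exists y.
- case/imfsetP => _ /imfsetP[y /= yin ->] ->; apply/in_opts_form_of.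
  by exists (tconj y); [rewrite topts_tconj map_f|rewrite form_of_tconj].
Qed.

Definition universe (U : set form) : Prop :=
  [/\ U form_zero,
      forall G H, U G -> U H -> U (form_add G H),
      forall G, U G -> U (form_conj G) &
      forall p G H, U G -> H \in opts p G -> U H].

Definition parental (U : set form) : Prop :=
  forall A B : {fset form}, A <> fset0 -> B <> fset0 ->
    (forall G, G \in A -> U G) -> (forall G, G \in B -> U G) ->
    U (mkform A B).

Definition absolute_universe (U : set form) : Prop := universe U /\ parental U.

Inductive dicot (G : form) : Prop :=
  Dicot of (opts Left G = fset0 <-> opts Right G = fset0)
         & (forall p H, H \in opts p G -> dicot H).

(** [reach P G H]: [H] is obtained from [G] by a possibly empty sequence of
    moves, not necessarily alternating, made by players satisfying [P]. *)
Inductive reach (P : player -> Prop) (G : form) : form -> Prop :=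
  | reach_refl : reach P G G
  | reach_step p H K : reach P G H -> P p -> K \in opts p H -> reach P G K.

Definition dead_ending (G : form) : Prop :=
  forall H, reach (fun _ => True) G H ->
  forall p, opts p H = fset0 ->
  forall K, reach (fun q => q = opponent p) H K -> opts p K = fset0.

Definition dicot_universe : set form := [set G | dicot G]%classic.

Definition dead_ending_universe : set form := [set G | dead_ending G]%classic.

(** [wins p q G]: under the misere convention, [p] has a winning strategy on [G]
    when [q] is to move. *)
Inductive wins (p : player) : player -> form -> Prop :=
  | wins_stuck G : opts p G = fset0 -> wins p p G
  | wins_move G H : H \in opts p G -> wins p (opponent p) H -> wins p p G
  | wins_reply G : opts (opponent p) G <> fset0 ->
      (forall H, H \in opts (opponent p) G -> wins p p H) ->
      wins p (opponent p) G.

Lemma wins_selfP (p : player) (G : form) :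
  wins p p G <->
  opts p G = fset0 \/ exists2 H, H \in opts p G & wins p (opponent p) H.
Proof.
split=> [|[e|[H Hin w]]]; [|exact: wins_stuck|exact: wins_move w].
move: {-2 3}p (erefl p) => q e w; case: w e => [K e|K H Hin w|K _ _].
- by left.
- by right; exists H.
- by case: (p).
Qed.

Lemma wins_opponentP (p : player) (G : form) :
  wins p (opponent p) G <->
  opts (opponent p) G <> fset0 /\
  forall H, H \in opts (opponent p) G -> wins p p H.
Proof.
split=> [|[ne h]]; last exact: wins_reply.
move: {-1}(opponent p) (erefl (opponent p)) => q e w.
case: w e => [K _|K H _ _|K]; by [case: (p)|].
Qed.

Lemma wins_determined (p q : player) (G : form) :
  wins (opponent p) q G <-> ~ wins p q G.
Proof.
suff self r : wins (opponent r) r G <-> ~ wins r r G.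
  have [->|->] : q = p \/ q = opponent p by case: p q => -[]; by [left|right].
    exact: self.
  have := self (opponent p); rewrite opponentK => -[h1 h2]; split=> [w /h1//|nw].
  by apply: contrapT => /h2.
elim/form_ind: G r => G IH r.
have := wins_opponentP (opponent r) G; rewrite opponentK => ->.
split=> [[ne h] /wins_selfP[//|[H Hin w]]|nw].
- have := IH _ _ Hin (opponent r); rewrite opponentK => -[/(_ w) + _].
  by apply; apply: h.
- split=> [e|H Hin]; first by apply: nw; apply: wins_stuck.
  apply: contrapT => /(IH _ _ Hin (opponent r)); rewrite opponentK => w.
  by apply: nw; apply: wins_move w.
Qed.

Inductive outcome_class : Set := outL | outR | outN | outP.

(** By [wins_determined], the player who does not win is the loser, so it is
    enough to record whether Left wins; see [outcomeP]. *)
Definition outcome (G : form) : outcome_class :=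
  match `[< wins Left Left G >], `[< wins Left Right G >] with
  | true, true => outL
  | false, false => outR
  | true, false => outN
  | false, true => outP
  end.

Lemma outcomeP (G : form) :
  match outcome G with
  | outL => forall q, wins Left q G
  | outR => forall q, wins Right q G
  | outN => forall q, wins q q G
  | outP => forall q, wins (opponent q) q G
  end.
Proof.
rewrite /outcome; case: asboolP => [w1|/wins_determined w1];
  by case: asboolP => [w2|/wins_determined w2] [].
Qed.

Definition distinguishable (U : set form) (G H : form) : Prop :=
  exists2 X, U X & outcome (form_add G X) <> outcome (form_add H X).

(** [proper_extension U V]: [V] is a proper extension of [U]. *)
Definition proper_extension (U V : set form) : Prop :=
  (U `<=` V)%classic /\
  exists2 G, V G & forall H, U H -> distinguishable V G H.

(* Main.v *)
(** Call [G] [k]-bounded when it is dead-ending and, at every position reachable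
    from it where one player is stuck, the numbers of moves that the opponent can
    make before being stuck too satisfy [m <= k * n] for any two of them.  These
    numbers add up under disjunctive sum, so the [k]-bounded forms are an absolute
    universe; it contains the dicots, already for [k = 0], and grows with [k].

    The form {0, k | } is (k+1)-bounded, as Left can exhaust it in 1 or in k+1
    moves.  No [k]-bounded [H] is at least as good for Left: there is a
    (k+1)-bounded [X] such that, Right starting, Left wins {0, k | } + X and loses
    [H + X].  If Right is stuck in [H], then [H] cannot be exhausted in both 1 and
    k+1 moves, and [X] forces Left to play a prescribed number of moves in the
    other component.  Otherwise Right moves to some [K] in [H], and [X] is built
    from the games given by induction for Left's options of [K]. *)
Require Import Defs.
From mathcomp Require Import all_boot classical_sets cardinality.
From mathcomp Require Import finmap boolp.

Set Implicit Arguments.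
Unset Strict Implicit.
Unset Printing Implicit Defensive.

Local Open Scope fset_scope.

(* Otherwise [done] and [//] may unfold the quotient without end. *)
Local Opaque opts mkform form_add form_conj.

(** * Options and stuck players in sums *)

Lemma in_opts_add (p : player) (G H K : form) :
  K \in opts p (form_add G H) <->
  (exists2 G', G' \in opts p G & K = form_add G' H) \/
  (exists2 H', H' \in opts p H & K = form_add G H').
Proof.
rewrite opts_form_add; split.
- by case/fsetUP => /imfsetP[x /= xin ->]; [left|right]; exists x.
- case=> -[x xin ->]; apply/fsetUP; [left|right]; by apply/imfsetP; exists x.
Qed.

Lemma opts_addl (p : player) (G H G' : form) :
  G' \in opts p G -> form_add G' H \in opts p (form_add G H).
Proof. by move=> G'in; apply/in_opts_add; left; exists G'. Qed.

Lemma opts_addr (p : player) (G H H' : form) :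
  H' \in opts p H -> form_add G H' \in opts p (form_add G H).
Proof. by move=> H'in; apply/in_opts_add; right; exists H'. Qed.

Lemma fset0_notin (T : choiceType) (A : {fset T}) :
  A = fset0 <-> forall x, x \notin A.
Proof.
split=> [-> x|h]; first by rewrite in_fset0.
by apply/fsetP => x; rewrite in_fset0; apply/negbTE/h.
Qed.

Lemma mem_neq0 (T : choiceType) (A : {fset T}) (x : T) : x \in A -> A <> fset0.
Proof. by move=> + e; rewrite e in_fset0. Qed.

Lemma opts_add_eq0 (p : player) (G H : form) :
  opts p (form_add G H) = fset0 <-> opts p G = fset0 /\ opts p H = fset0.
Proof.
split=> [/fset0_notin h|[/fset0_notin hG /fset0_notin hH]].
- split; apply/fset0_notin => x; apply/negP => xin.
  + by have /negP := h (form_add x H); apply; apply: opts_addl.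
  + by have /negP := h (form_add G x); apply; apply: opts_addr.
- apply/fset0_notin => x; apply/negP => /in_opts_add[] [y yin _].
  + by have := hG y; rewrite yin.
  + by have := hH y; rewrite yin.
Qed.

Lemma opts_zero (p : player) : opts p form_zero = fset0.
Proof. by rewrite opts_mkform; case: p. Qed.

(** * Run lengths and the universes of bounded forms *)

Fixpoint run (p : player) (n : nat) (G : form) : Prop :=
  if n is m.+1 then exists2 H, H \in opts p G & run p m H
  else opts p G = fset0.

(** A run of the sum interleaves a run of each summand; both are complete because a player stuck in
    the sum is stuck in both. *)
Lemma run_add (p : player) (n : nat) (G H : form) :
  run p n (form_add G H) ->
  exists a b : nat, [/\ n = (a + b)%N, run p a G & run p b H].
Proof.
elim: n G H => [|n IHn] G H /=.
  by move/opts_add_eq0 => -[hG hH]; exists 0, 0.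
case=> _ /in_opts_add[] [x xin ->] /IHn[a [b [-> ra rb]]].
- by exists a.+1, b; split=> //; exists x.
- by exists a, b.+1; split=> //; [rewrite addnS|exists x].
Qed.

Lemma run_conj (p : player) (n : nat) (G : form) :
  run p n (form_conj G) -> run (opponent p) n G.
Proof.
elim: n G => [|n IHn] G /=; rewrite opts_form_conj.
- move/fset0_notin => h; apply/fset0_notin => x; apply/negP => xin.
  by have /negP := h (form_conj x); apply; apply/imfsetP; exists x.
- by case=> _ /imfsetP[x /= xin ->] /IHn; exists x.
Qed.

(** The first clause asks for dead-ending over a single move; heredity supplies the rest. As [m] and
    [n] may be exchanged, [k] bounds the ratio of run lengths both ways. *)
Inductive bounded (k : nat) (G : form) : Prop :=
  Bounded of
    (forall p, opts (opponent p) G = fset0 ->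
       (forall H, H \in opts p G -> opts (opponent p) H = fset0) /\
       (forall m n, run p m G -> run p n G -> m <= k * n)) &
    (forall p H, H \in opts p G -> bounded k H).

Definition bounded_universe (k : nat) : set form := [set G | bounded k G]%classic.

Lemma bounded_opts (k : nat) (p : player) (G H : form) :
  bounded k G -> H \in opts p G -> bounded k H.
Proof. by case=> _ h; apply: h. Qed.

(** Neither player is stuck at the root, so the clause about stuck players is vacuous there. *)
Lemma bounded_mkform (k : nat) (A B : {fset form}) :
  A <> fset0 -> B <> fset0 ->
  (forall G, G \in A -> bounded k G) -> (forall G, G \in B -> bounded k G) ->
  bounded k (mkform A B).
Proof.
by move=> A0 B0 hA hB; split=> -[]; rewrite opts_mkform.
Qed.

Lemma bounded_zero (k : nat) : bounded k form_zero.
Proof.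
split=> [p _|p H]; last by rewrite opts_zero in_fset0.
split=> [H|[|m] n] //=; first by rewrite opts_zero in_fset0.
by case=> H; rewrite opts_zero in_fset0.
Qed.

Lemma bounded_add (k : nat) (G H : form) :
  bounded k G -> bounded k H -> bounded k (form_add G H).
Proof.
elim/form_ind: G H => G IHG; elim/form_ind => H IHH bG bH; split; last first.
  move=> p K /in_opts_add[] [x xin ->].
  - exact: IHG xin _ (bounded_opts bG xin) bH.
  - exact: IHH xin bG (bounded_opts bH xin).
case: (bG) (bH) => [hG _] [hH _].
move=> p /opts_add_eq0 [/[dup] eG /hG [dG rG] /[dup] eH /hH [dH rH]]; split.
- move=> K /in_opts_add[] [x xin ->]; apply/opts_add_eq0; split=> //.
  + exact: dG.
  + exact: dH.
- move=> m n /run_add[a [b [-> ra rb]]] /run_add[c [d [-> rc rd]]].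
  by rewrite mulnDr leq_add //; [apply: rG|apply: rH].
Qed.

Lemma bounded_conj (k : nat) (G : form) : bounded k G -> bounded k (form_conj G).
Proof.
elim/form_ind: G => G IH bG; split; last first.
  move=> p H; rewrite opts_form_conj => /imfsetP[x /= xin ->].
  exact: IH xin (bounded_opts bG xin).
(* A run of length 0 means being stuck, so [run_conj] transfers stuckness too. *)
case: bG => hG _ p /(@run_conj _ 0) e; have [d r] := hG _ e; split.
- move=> H; rewrite opts_form_conj => /imfsetP[x /= xin ->].
  rewrite opts_form_conj d //; apply/fset0_notin => y.
  by apply/negP => /imfsetP[z /=]; rewrite in_fset0.
- by move=> m n /run_conj + /run_conj; apply: r.
Qed.

Lemma bounded_absolute (k : nat) : absolute_universe (bounded_universe k).
Proof.
split; last exact: bounded_mkform.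
split.
- exact: bounded_zero.
- by move=> G H; apply: bounded_add.
- by move=> G; apply: bounded_conj.
- by move=> p G H; apply: bounded_opts.
Qed.

Lemma bounded_leq (k l : nat) (G : form) : k <= l -> bounded k G -> bounded l G.
Proof.
move=> kl; elim/form_ind: G => G IH [h1 h2].
split=> [p /h1[d r]|p H Hin]; last exact: IH Hin (h2 _ _ Hin).
split=> // m n rm rn; apply: leq_trans (r _ _ rm rn) _.
by rewrite leq_mul2r kl orbT.
Qed.

(** Where one player is stuck in a dicot, so is the other, and the only run is the empty one. *)
Lemma dicot_bounded (k : nat) (G : form) : dicot G -> bounded k G.
Proof.
elim/form_ind: G => G IH [e h]; split=> [p ep|p H Hin]; last exact: IH Hin (h _ _ Hin).
have e0 : opts p G = fset0 by case: p ep => /e.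
by rewrite e0; split=> // -[|m] n //= [H]; rewrite e0 in_fset0.
Qed.

Lemma bounded_dead_ending (k : nat) (G : form) : bounded k G -> dead_ending G.
Proof.
have reachB P H K : reach P H K -> bounded k H -> bounded k K.
  elim=> [//|p H' K' _ IH _ K'in /IH bH']; exact: bounded_opts bH' K'in.
move=> bG H /reachB/(_ bG) bH p e K rHK.
(* Boundedness is carried along so that the one-move clause applies again after each move. *)
suff : opts p K = fset0 /\ bounded k K by case.
elim: rHK => [//|q H' K' _ [e' bH'] -> K'in].
split; last exact: bounded_opts bH' K'in.
case: bH' => /(_ (opponent p)); rewrite opponentK => /(_ e')[d _] _.
exact: d.
Qed.

(** * Integers as threats and ladders as move counters *)

Fixpoint int_form (n : nat) : form :=
  if n is m.+1 then mkform [fset int_form m] fset0 else form_zero.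

Lemma opts_int_Right (n : nat) : opts Right (int_form n) = fset0.
Proof. by case: n => [|n]; rewrite /= opts_mkform. Qed.

Lemma run_int (m n : nat) : run Left m (int_form n) <-> m = n.
Proof.
elim: m n => [|m IHm] [|n] /=; rewrite ?opts_mkform; split=> //.
- by move/fset0_notin/(_ (int_form n)); rewrite in_fset1 eqxx.
- by case=> H; rewrite in_fset0.
- by case=> H; rewrite in_fset1 => /eqP-> /IHm->.
- by case=> <-; exists (int_form m); [rewrite in_fset1|apply/IHm].
Qed.

Lemma bounded_int (k n : nat) : bounded k.+1 (int_form n).
Proof.
elim: n => [|n IHn]; first exact: bounded_zero.
split=> -[]; rewrite !opts_mkform.
- move=> _; split=> [H|m l].
    by rewrite in_fset1 => /eqP->; apply: opts_int_Right.
  by move=> /run_int-> /run_int->; rewrite leq_pmull.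
- by move/fset0_notin/(_ (int_form n)); rewrite in_fset1 eqxx.
- by move=> H; rewrite in_fset1 => /eqP->.
- by move=> H; rewrite in_fset0.
Qed.

(** Lets a single large integer serve as a threat against all options at once. *)
Lemma fset_eventually (A : {fset form}) (P : form -> nat -> Prop) :
  (forall x, x \in A -> exists N, forall n, N <= n -> P x n) ->
  exists N, forall x n, x \in A -> N <= n -> P x n.
Proof.
move=> h; have /choice[f hf] x :
    exists N, x \in A -> forall n, N <= n -> P x n.
  by case: (boolP (x \in A)) => [/h[N hN]|_]; [exists N|exists 0].
exists (\max_(x <- A) f x) => x n xin le; apply: hf => //.
by apply: leq_trans le; rewrite (big_rem x) //= leq_maxl.
Qed.

(* Left spends all her moves in a large integer, while every move of Right is in
   [G]: Right gets stuck, hence wins, first. *)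
Lemma wins_add_int (G : form) :
  exists N, forall n, N <= n -> forall q, wins Right q (form_add G (int_form n)).
Proof.
elim/form_ind: G => G IH.
have [N hN] : exists N, forall p H n, H \in opts p G -> N <= n ->
    forall q, wins Right q (form_add H (int_form n)).
  have [a ha] := fset_eventually (IH Left); have [b hb] := fset_eventually (IH Right).
  exists (maxn a b) => p H n Hin; rewrite geq_max => /andP[an bn].
  by case: p Hin => Hin; [apply: ha|apply: hb].
have right n : N <= n -> wins Right Right (form_add G (int_form n)).
  move=> Nn; apply/wins_selfP.
  case: (fset_0Vmem (opts Right G)) => [e|[H Hin]].
    by left; apply/opts_add_eq0; rewrite opts_int_Right.
  by right; exists (form_add H (int_form n)); [apply: opts_addl|apply: hN Hin _ _].
(* The extra 1 pays for Left's move in the integer, and keeps her from being stuck. *)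
exists N.+1 => -[//|n] Nn; case; last by apply: right; apply: ltnW.
have nin : int_form n \in opts Left (int_form n.+1).
  by rewrite opts_mkform in_fset1.
apply: (@wins_reply Right); first exact: mem_neq0 (opts_addr _ nin).
move=> H /in_opts_add[] [x xin ->]; first by apply: (hN _ _ _ xin); apply: ltnW.
by move: xin; rewrite opts_mkform in_fset1 => /eqP->; apply: right.
Qed.

(** The Left option 1 keeps Left from being stuck, hence from winning, before Right has come down to
    [form_zero]. *)
Fixpoint ladder (i : nat) : form :=
  mkform [fset int_form 1] [fset (if i is j.+1 then ladder j else form_zero)].

Lemma ladder_mkform (i : nat) : ladder i =
  mkform [fset int_form 1] [fset (if i is j.+1 then ladder j else form_zero)].
Proof. by case: i. Qed.

Lemma bounded_ladder (k i : nat) : bounded k.+1 (ladder i).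
Proof.
elim: i => [|i IHi]; apply: bounded_mkform; try exact: mem_neq0 (fset11 _);
  move=> G /fset1P->; by [exact: bounded_int|exact: bounded_zero|exact: IHi].
Qed.

Lemma wins_Right_stuck (G : form) : opts Right G = fset0 -> ~ wins Left Right G.
Proof. by move=> e /(wins_opponentP Left)[]. Qed.

(* Right's moves are forced, and Left may only answer in [G]: moving to [1] would
   leave Right stuck.  So Left must exhaust [G] in exactly [i] moves. *)
Lemma wins_ladder (k i : nat) (G : form) : bounded k G -> opts Right G = fset0 ->
  wins Left Right (form_add G (ladder i)) <-> run Left i G.
Proof.
have redR j H : opts Right H = fset0 ->
    wins Left Right (form_add H (ladder j)) <->
    wins Left Left (form_add H (if j is j'.+1 then ladder j' else form_zero)).
  move=> e; set z := if j is _.+1 then _ else _.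
  have zin : z \in opts Right (ladder j).
    by rewrite ladder_mkform opts_mkform in_fset1.
  split=> [/(wins_opponentP Left)[_]|w]; first by apply; apply: opts_addr.
  apply: (@wins_reply Left); first exact: mem_neq0 (opts_addr _ zin).
  move=> K /in_opts_add[] [x]; first by rewrite e in_fset0.
  by rewrite ladder_mkform opts_mkform in_fset1 => /eqP-> ->.
(* Right starts, so his [i.+1] moves leave Left [i] replies before the turn at which she must be
   stuck. *)
move=> bG e; elim: i G bG e => [|i IHi] G bG e; rewrite redR // wins_selfP.
all: have [d _] : (forall H, H \in opts Left G -> opts Right H = fset0) /\ True
  by case: bG => /(_ Left e)[].
- split=> [[/opts_add_eq0[]//|]|e']; last by left; apply/opts_add_eq0; rewrite opts_zero.
  case=> _ /in_opts_add[] [x xin ->]; last by move: xin; rewrite opts_zero in_fset0.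
  by case/wins_Right_stuck; apply/opts_add_eq0; rewrite opts_zero d.
- split=> [[/opts_add_eq0[_]|]|[x xin r]].
  + by rewrite ladder_mkform opts_mkform => /fset0_notin/(_ (int_form 1)); rewrite fset11.
  + case=> _ /in_opts_add[] [x xin ->].
      by move/(IHi _ (bounded_opts bG xin) (d _ xin)); exists x.
    move: xin; rewrite ladder_mkform opts_mkform in_fset1 => /eqP->.
    by case/wins_Right_stuck; apply/opts_add_eq0; rewrite e opts_int_Right.
  + right; exists (form_add x (ladder i)); first exact: opts_addl.
    exact/(IHi _ (bounded_opts bG xin) (d _ xin)).
Qed.

(** * The separating form *)

Definition separator (k : nat) : form :=
  mkform [fset form_zero; int_form k] fset0.

Lemma opts_separator (k : nat) : opts Right (separator k) = fset0.
Proof. by rewrite opts_mkform. Qed.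

Lemma run_separator (k m : nat) :
  run Left m (separator k) <-> m = 1 \/ m = k.+1.
Proof.
case: m => [|m] /=; rewrite opts_mkform; split.
- by move/fset0_notin/(_ form_zero); rewrite fset21.
- by case.
- by case=> H /fset2P[]-> => [/(run_int m 0)|/run_int] ->; [left|right].
- by case=> -[->]; [exists form_zero|exists (int_form k)];
    rewrite ?fset21 ?fset22 //; [apply: opts_zero|apply/run_int].
Qed.

Lemma bounded_separator (k : nat) : bounded k.+1 (separator k).
Proof.
split=> -[].
- move=> _; split=> [H|m n].
    by rewrite opts_mkform => /fset2P[]->; rewrite ?opts_zero ?opts_int_Right.
  move=> /run_separator hm /run_separator hn; apply: (@leq_trans k.+1).
    by case: hm => ->.
  by rewrite leq_pmulr //; case: hn => ->.
- by rewrite opts_mkform => /fset0_notin/(_ form_zero); rewrite fset21.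
- by move=> H; rewrite opts_mkform => /fset2P[]->;
    [apply: bounded_zero|apply: bounded_int].
- by move=> H; rewrite opts_mkform in_fset0.
Qed.

Definition star : form := mkform [fset form_zero] [fset form_zero].

(** Left moves to [form_zero] in the separator; Right's forced move in [star] then leaves her
    stuck. *)
Lemma wins_separator_star (k : nat) :
  wins Left Left (form_add (separator k) star).
Proof.
have sE p : opts p star = [fset form_zero] by rewrite opts_mkform; case: p.
apply: (@wins_move Left _ (form_add form_zero star)).
  by apply: opts_addl; rewrite opts_mkform fset21.
have zin : form_zero \in opts Right star by rewrite sE fset11.
apply: (@wins_reply Left); first exact: mem_neq0 (opts_addr _ zin).
move=> H /in_opts_add[] [x]; first by rewrite opts_zero in_fset0.
rewrite sE => /fset1P-> ->; apply: wins_stuck.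
by apply/opts_add_eq0; rewrite opts_zero.
Qed.

(** * Separation from every bounded form *)

Definition separated (k : nat) (q : player) (G H : form) : Prop :=
  exists X, [/\ bounded k X, wins Left q (form_add G X) &
                wins Right q (form_add H X)].

(** In {X | N}, Left's move to [X] passes the turn to Right. Next to [H] this loses, and Right
    answers any move inside [H] by moving to the large integer [N]. *)
Lemma separated_Left (k : nat) (G H : form) :
  separated k.+1 Right G H -> separated k.+1 Left G H.
Proof.
case=> X [bX wG wH].
have [N hN] := fset_eventually (fun x (_ : x \in opts Left H) => wins_add_int x).
pose Z := mkform [fset X] [fset int_form N].
have ZL : X \in opts Left Z by rewrite opts_mkform fset11.
have ZR : int_form N \in opts Right Z by rewrite opts_mkform fset11.
exists Z; split.
- apply: bounded_mkform; try exact: mem_neq0 (fset11 _);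
    move=> K /fset1P->; by [exact: bX|exact: bounded_int].
- exact: (@wins_move Left _ _ (opts_addr _ ZL)).
- apply: (@wins_reply Right); first exact: mem_neq0 (opts_addr _ ZL).
  move=> K /in_opts_add[] [x xin ->].
    by apply: (@wins_move Right _ _ (opts_addr _ ZR)); apply: hN.
  by move: xin; rewrite opts_mkform => /fset1P->.
Qed.

(* Right wins on [H] by moving to [K]: Left's answer in [K] meets the matching
   option of the distinguishing game, and the integer is Right's threat against
   any other answer. *)
Lemma separated_step (k : nat) (H K : form) : K \in opts Right H ->
  (forall L, L \in opts Left K -> separated k.+1 Left (separator k) L) ->
  separated k.+1 Right (separator k) H.
Proof.
move=> Kin sep; have [N /(_ N (leqnn N) Right) hN] := wins_add_int K.
have /choice[Z hZ] L : exists Z, L \in opts Left K ->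
    [/\ bounded k.+1 Z, wins Left Left (form_add (separator k) Z) &
        wins Right Left (form_add L Z)].
  by case: (boolP (L \in opts Left K)) => [/sep[Z hZ]|_];
    [exists Z|exists form_zero].
(* [star] keeps [B] nonempty even if [K] has no Left option, and Left wins against it. *)
pose B := star |` [fset Z L | L in opts Left K].
have BP b : b \in B -> b = star \/ exists2 L, L \in opts Left K & b = Z L.
  by case/fsetUP => [/fset1P->|/imfsetP[L /= Lin ->]]; [left|right; exists L].
pose X := mkform [fset int_form N] B.
have XL : int_form N \in opts Left X by rewrite opts_mkform fset11.
have starB : star \in B by apply/fsetUP; left; apply: fset11.
have XR : star \in opts Right X by rewrite opts_mkform.
exists X; split.
- apply: bounded_mkform; [exact: mem_neq0 (fset11 _)|exact: mem_neq0 starB| |].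
    by move=> G /fset1P->; apply: bounded_int.
  move=> b /BP[->|[L /hZ[bZ _ _] ->//]].
  by apply: bounded_mkform; try exact: mem_neq0 (fset11 _);
    move=> G /fset1P->; exact: bounded_zero.
- apply: (@wins_reply Left); first exact: mem_neq0 (opts_addr _ XR).
  move=> G /in_opts_add[] [x]; first by rewrite opts_separator in_fset0.
  rewrite opts_mkform => /BP[->|[L /hZ[_ w _] ->]] -> //.
  exact: wins_separator_star.
- apply: (@wins_move Right _ _ (opts_addl _ Kin)).
  apply: (@wins_reply Right); first exact: mem_neq0 (opts_addr _ XL).
  move=> G /in_opts_add[] [x xin ->].
    have [_ _ w] := hZ _ xin.
    apply: (@wins_move Right _ (form_add x (Z x))) w.
    apply: opts_addr; rewrite opts_mkform; apply/fsetUP; right.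
    by apply/imfsetP; exists x.
  by move: xin; rewrite opts_mkform => /fset1P->.
Qed.

Lemma separated_bounded (k : nat) (H : form) :
  bounded k H -> separated k.+1 Right (separator k) H.
Proof.
(* The induction has to reach options of options: a Right move to [K], then a Left move to [L]. *)
suff : (bounded k H -> separated k.+1 Right (separator k) H) /\
    (forall p K, K \in opts p H -> bounded k K ->
       separated k.+1 Right (separator k) K) by case.
elim/form_ind: H => H IH; split; last by move=> p K /IH[].
move=> bH; case: (fset_0Vmem (opts Right H)) => [e|[K Kin]]; last first.
  apply: separated_step (Kin) _ => L Lin; apply: separated_Left.
  have [_] := IH _ _ Kin; apply; first exact: Lin.
  exact: bounded_opts (bounded_opts bH Kin) Lin.
(* If [H] had runs of both lengths 1 and [k.+1], then [k.+1 <= k * 1]. *)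
have [i ri nri] : exists2 i, run Left i (separator k) & ~ run Left i H.
  apply: contrapT => h.
  have r i : i = 1 \/ i = k.+1 -> run Left i H.
    by move/run_separator => ri; apply: contrapT => nri; apply: h; exists i.
  case: bH => /(_ Left e)[_ /(_ k.+1 1)] + _.
  by rewrite muln1 ltnn => /(_ (r _ (or_intror erefl)) (r _ (or_introl erefl))).
exists (ladder i); split; first exact: bounded_ladder.
- exact/(wins_ladder i (bounded_separator k) (opts_separator k)).
- apply: contrapT => /(wins_determined Left); rewrite (wins_ladder i bH e) => //.
Qed.

(** * Proper extensions and the infinite chain *)

Lemma bounded_proper (k : nat) (V : set form) :
  (bounded_universe k.+1 `<=` V)%classic ->
  forall H, bounded k H -> distinguishable V (separator k) H.
Proof.
move=> sub H /separated_bounded[X [bX wG wH]]; exists X; first exact: sub.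
have {}wH : ~ wins Left Right (form_add H X) by apply/(wins_determined Right).
move: wG wH; rewrite /outcome => wG wH.
(* The result with Right starting already tells the outcomes apart, whatever happens when Left
   starts. *)
rewrite (asboolT wG) (asboolF wH).
by do 2!case: asboolP.
Qed.

(** Sandwiching covers the dicots below, the dead-ending forms above and the chain itself. *)
Lemma bounded_proper_extension (k : nat) (U V : set form) :
  (U `<=` bounded_universe k)%classic -> (bounded_universe k.+1 `<=` V)%classic ->
  proper_extension U V.
Proof.
move=> sU sV; split.
  by move=> G /sU bG; apply: sV; apply: bounded_leq bG.
exists (separator k); first by apply: sV; apply: bounded_separator.
by move=> H /sU; apply: bounded_proper.
Qed.

(** Makes the indexing of the chain injective, so that the family is infinite. *)
Lemma proper_extension_irr (U : set form) : ~ proper_extension U U.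
Proof. by case=> _ [G UG /(_ _ UG)[X _]]. Qed.

Theorem theorem26 :
  exists F : set (set form),
    infinite_set F /\
    (forall U : set form, F U ->
       absolute_universe U /\
       (dicot_universe `<=` U)%classic /\
       (U `<=` dead_ending_universe)%classic /\
       proper_extension dicot_universe U /\
       proper_extension U dead_ending_universe) /\
    (forall U V : set form, F U -> F V -> U <> V ->
       proper_extension U V \/ proper_extension V U).
Proof.
have mono k l : k <= l -> (bounded_universe k `<=` bounded_universe l)%classic.
  by move=> kl G; apply: bounded_leq.
have chain k l : k < l -> proper_extension (bounded_universe k) (bounded_universe l).
  by move=> kl; apply: (@bounded_proper_extension k); [exact: subset_refl|exact: mono].
(* Indices start at 1: dicots are 0-bounded, so each member extends them properly. *)
exists (range (fun k => bounded_universe k.+1)); split; [|split].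
- rewrite (eq_finite_set (inj_card_eq _)); first exact: infinite_nat.
  move=> k l _ _ e; case: (ltngtP k l) => [kl|lk|-> //].
  + by have := chain k.+1 l.+1 kl; rewrite e => /proper_extension_irr.
  + by have := chain l.+1 k.+1 lk; rewrite e => /proper_extension_irr.
- move=> _ [k _ <-]; split; first exact: bounded_absolute.
  split; first by move=> G; apply: dicot_bounded.
  split; first by move=> G; apply: bounded_dead_ending.
  split; apply: bounded_proper_extension.
  + by move=> G; apply: (@dicot_bounded 0).
  + exact: mono.
  + exact: subset_refl.
  + by move=> G; apply: bounded_dead_ending.
- move=> _ _ [k _ <-] [l _ <-] ne.
  by case: (ltngtP k l) => [kl|lk|e]; [left; apply: chain|right; apply: chain|
    case: ne; rewrite e].
Qed.
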